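(* Let $\mathcal{G}\subset U(2)$ be any fixed finite universal set of single-qubit quantum gates. For each positive integer $p$ let $\theta_p=\frac{\pi}{2p}$ and $$R(\theta_p)=\begin{pmatrix}\cos\theta_p & \sin\theta_p\\ -\sin\theta_p & \cos\theta_p\end{pmatrix}.$$ Then no algorithm can approximate all $R(\theta_p)$ with $p\le p_0$ to an accuracy of $\epsilon_p=\frac{\epsilon}{2p}$ using $o\!\left(\log\left(\frac{1}{\epsilon}\log p_0\right)\right)$ gates from $\mathcal{G}$, for $p_0$ sufficiently large and $\epsilon$ sufficiently small. That is, there is no function $\ell(p_0,\epsilon)$ with $\ell(p_0,\epsilon)=o\!\left(\log\left(\frac1\epsilon\log p_0\right)\right)$ as $p_0\to\infty$ and $\epsilon\to 0^+$ such that, for all sufficiently large integers $p_0$ and all sufficiently small $\epsilon>0$, for every integer $1\le p\le p_0$ there is a gate array over $\mathcal{G}$ of length at most $\ell(p_0,\epsilon)$ that approximates $R(\theta_p)$ to accuracy $\frac{\epsilon}{2p}$.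
   Context: A finite set $\mathcal{G}\subset U(2)$ is universal if every unitary operator in $U(2)$ can be approximated to arbitrary accuracy by finite products of elements of $\mathcal{G}$. The set $\mathcal{G}$ is chosen once and for all, independently of $p$, $p_0$ and $\epsilon$. A gate array of length $L$ over $\mathcal{G}$ is a product $U_1U_2\cdots U_L$ with each $U_i\in\mathcal{G}$. A gate array with product $V$ approximates a unitary $U$ to accuracy $\eta$ if $\|U-V\|_2\le\eta$, where $\|\cdot\|_2$ is the operator (spectral) norm. The notation $\ell(p_0,\epsilon)=o(f(p_0,\epsilon))$ as $p_0\to\infty$, $\epsilon\to0^+$ means: for every $c>0$ there are $P$ and $\epsilon_*>0$ such that $\ell(p_0,\epsilon)\le c\,f(p_0,\epsilon)$ for all $p_0\ge P$ and $0<\epsilon\le\epsilon_*$. *)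

(* Defs.v *)
From mathcomp Require Import all_boot all_order all_algebra.
From mathcomp Require Import spectral.
From mathcomp Require Import complex.
From mathcomp Require Import all_classical all_reals all_analysis.

Set Implicit Arguments.
Unset Strict Implicit.
Unset Printing Implicit Defensive.

Import Order.TTheory GRing.Theory Num.Theory.

Local Open Scope classical_set_scope.
Local Open Scope ring_scope.
Local Open Scope complex_scope.

(* [Normc.normc] is the [R]-valued modulus; the norm of [R[i]] as a
   [numDomainType] takes its values in [R[i]], where suprema are unavailable. *)
Definition l2norm (R : realType) (n : nat) (v : 'cV[R[i]]_n) : R :=
  Num.sqrt (\sum_(i < n) Normc.normc (v i 0) ^+ 2).

Definition opnorm (R : realType) (m n : nat) (A : 'M[R[i]]_(m, n)) : R :=
  sup [set l2norm (A *m v) | v in [set v : 'cV[R[i]]_n | l2norm v <= 1]].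

(* A gate array is encoded by its list of gates. *)
Definition gate_array (R : realType) (G : set 'M[R[i]]_2)
  (s : seq 'M[R[i]]_2) : Prop := forall U, U \in s -> G U.

Definition array_product (R : realType) (s : seq 'M[R[i]]_2) : 'M[R[i]]_2 :=
  \prod_(U <- s) U.

Definition approximates (R : realType) (s : seq 'M[R[i]]_2)
  (U : 'M[R[i]]_2) (eta : R) : Prop :=
  opnorm (U - array_product s) <= eta.

Definition universal (R : realType) (G : set 'M[R[i]]_2) : Prop :=
  forall U : 'M[R[i]]_2, U \is unitarymx ->
  forall eta : R, 0 < eta ->
  exists s, gate_array G s /\ approximates s U eta.

Definition rotation (R : realType) (t : R) : 'M[R[i]]_2 :=
  \matrix_(i < 2, j < 2)
    (if i == j then cos t else if (i < j)%N then sin t else - sin t)%:C.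

Definition theta (R : realType) (p : nat) : R := pi / (2 * p%:R).

(* The joint limit as the first argument tends to infinity and the second to 0
   from the right; one-sided: no absolute value is taken on [l]. *)
Definition littleo_infty_0 (R : realType) (l f : nat -> R -> R) : Prop :=
  forall c : R, 0 < c -> exists (P : nat) (e1 : R), 0 < e1 /\
    forall (p0 : nat) (e : R), (P <= p0)%N -> 0 < e <= e1 ->
      l p0 e <= c * f p0 e.

Lemma opnorm_has_sup (R : realType) (m n : nat) (A : 'M[R[i]]_(m, n)) :
  has_sup [set l2norm (A *m v) | v in [set v : 'cV[R[i]]_n | l2norm v <= 1]].
Proof.
have n0 (x : R[i]) : 0 <= Normc.normc x by case: x => a b; exact: sqrtr_ge0.
have nD (x y : R[i]) : Normc.normc (x + y) <= Normc.normc x + Normc.normc y.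
  by rewrite -lecR rmorphD; exact: (ler_normD x y).
split.
  exists (l2norm (A *m 0)), 0 => //=.
  by rewrite /l2norm big1 ?sqrtr0 // => i _; rewrite mxE Normc.normc0 expr0n.
exists (Num.sqrt (\sum_i (\sum_j Normc.normc (A i j)) ^+ 2)) => _ [v /= v1 <-].
have vj j : Normc.normc (v j 0) <= 1.
  apply: le_trans v1; rewrite -[leLHS]ger0_norm // -sqrtr_sqr /l2norm.
  rewrite ler_wsqrtr // (bigD1 j) //= lerDl sumr_ge0 // => k _.
  exact: sqr_ge0.
rewrite ler_wsqrtr //; apply: ler_sum => i _; rewrite mxE.
rewrite lerXn2r ?nnegrE ?sumr_ge0 //.
elim/big_ind2: _ => [|x1 x2 y1 y2 h1 h2|j _]; first by rewrite Normc.normc0.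
  by apply: le_trans (nD _ _) _; exact: lerD.
by rewrite Normc.normcM ler_piMr.
Qed.

(* Main.v *)
Require Import Defs.
From mathcomp Require Import all_boot all_order all_algebra.
From mathcomp Require Import spectral.
From mathcomp Require Import complex.
From mathcomp Require Import all_classical all_reals all_analysis.
From mathcomp Require Import ring lra.

(* Only the angles with p = 2^j are needed, and epsilon stays fixed.  Halving
   the angle shrinks its sine by a factor between 7/5 and 2, so
   sin theta_(2^j) >= 2^-j and the balls of radius epsilon / 2^(j+1) about the
   rotations with 0 <= j <= n are pairwise disjoint, already when projected to
   the upper right entry.  For p0 = 2^n this forces n + 1 distinct products of
   gates, whereas K gates give at most (K + 1)^L products of length at most L.
   Hence L >= ln (n + 1) / ln (K + 1), which is not
   o(ln (epsilon^-1 * n * ln 2)) as n grows. *)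

Set Implicit Arguments.
Unset Strict Implicit.
Unset Printing Implicit Defensive.

Import Order.TTheory GRing.Theory Num.Theory.

Local Open Scope classical_set_scope.
Local Open Scope ring_scope.
Local Open Scope complex_scope.

(** The entry is a coordinate of the image of the basis vector [delta_mx j 0], which has norm 1. *)
Lemma normc_entry_le_opnorm (R : realType) (m n : nat) (A : 'M[R[i]]_(m, n))
  (i : 'I_m) (j : 'I_n) : Normc.normc (A i j) <= opnorm A.
Proof.
have n0 (x : R[i]) : 0 <= Normc.normc x by case: x => a b; exact: sqrtr_ge0.
have unit_norm : l2norm (delta_mx j 0 : 'cV[R[i]]_n) <= 1.
  rewrite /l2norm (bigD1 j) //= mxE !eqxx Normc.normc1 big1 => [|k /negPf kj].
    by rewrite addr0 expr1n sqrtr1.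
  by rewrite mxE kj Normc.normc0 expr0n.
have [_ ubA] := opnorm_has_sup A.
have : l2norm (A *m delta_mx j 0) <= opnorm A.
  by apply: (ub_le_sup ubA); exists (delta_mx j 0).
apply: le_trans.
rewrite -colE /l2norm -[leLHS]ger0_norm // -sqrtr_sqr ler_wsqrtr //.
rewrite (bigD1 i) //= mxE lerDl sumr_ge0 // => k _; exact: sqr_ge0.
Qed.

(** Reduces matrix approximation to one real number: the upper right entry of the rotation is the
    real [sin t], and a real part is bounded by the modulus. *)
Lemma approximates_rotation_entry (R : realType) (s : seq 'M[R[i]]_2)
  (t eta : R) : approximates s (rotation t) eta ->
  `|sin t - complex.Re (array_product s 0 1)| <= eta.
Proof.
rewrite /approximates; apply: le_trans.
apply: le_trans (normc_entry_le_opnorm _ 0 1).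
rewrite !mxE /=; case: (array_product s 0 1) => a b /=.
by rewrite -sqrtr_sqr ler_wsqrtr // lerDl sqr_ge0.
Qed.

Lemma theta_double (R : realType) (p : nat) :
  theta R p = theta R (2 * p) *+ 2.
Proof.
rewrite /theta natrM [in RHS]invfM.
by move: (_^-1) => x; field.
Qed.

Lemma theta_exp2_bounds (R : realType) (j : nat) :
  0 < theta R (2 ^ j) <= pi / 2.
Proof.
have pi0 := pi_gt0 R.
elim: j => [|j /andP[]]; first by rewrite /theta mulr1; lra.
rewrite theta_double -expnS; lra.
Qed.

Lemma sin_theta_exp2_gt0 (R : realType) (j : nat) :
  0 < sin (theta R (2 ^ j)).
Proof.
have /andP[t0 tpi] := theta_exp2_bounds R j.
by apply: sin_gt0_pi; have := pi_gt0 R; lra.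
Qed.

(** Since sin 2u = 2 sin u cos u <= 2 sin u, halving the angle at most halves the sine, which starts
    at 1. *)
Lemma sin_theta_exp2_ge (R : realType) (j : nat) :
  (2 ^+ j)^-1 <= sin (theta R (2 ^ j)).
Proof.
elim: j => [|j IHj]; first by rewrite /theta mulr1 sin_pihalf invr1.
move: IHj; rewrite [theta R (2 ^ j)]theta_double -expnS sin_mulr2n exprS invfM.
have := sin_theta_exp2_gt0 R j.+1; have := cos_le1 (theta R (2 ^ j.+1)).
move: (sin _) (cos _) (2 ^+ j)^-1 => x y z; nra.
Qed.

Lemma sin_theta_exp2_half (R : realType) (j : nat) :
  7 / 5 * sin (theta R (2 ^ j.+1)) <= sin (theta R (2 ^ j)).
Proof.
have pi0 := pi_gt0 R.
have /andP[t0 tpi] := theta_exp2_bounds R j.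
have /andP[u0 upi] := theta_exp2_bounds R j.+1.
have : 0 <= cos (theta R (2 ^ j)) by apply: cos_ge0_pihalf; lra.
have : 0 <= cos (theta R (2 ^ j.+1)) by apply: cos_ge0_pihalf; lra.
have := sin_theta_exp2_gt0 R j.+1.
rewrite [theta R (2 ^ j)]theta_double -expnS sin_mulr2n cos_mulr2n.
move: (sin _) (cos _) => x y x0 y0 y2.
(* The doubled angle is at most pi/2, so 2 y^2 - 1 >= 0; 7/10 is a rational lower bound for 1/sqrt
   2. *)
have y_ge : 7 / 10 <= y.
  by rewrite leNgt; apply/negP => y_lt; nra.
rewrite -mulrnAl ler_pM2r //; lra.
Qed.

Lemma sin_theta_exp2_gap (R : realType) (j k : nat) : (j < k)%N ->
  7 / 5 * sin (theta R (2 ^ k)) <= sin (theta R (2 ^ j)).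
Proof.
elim: k => // k IHk; rewrite ltnS leq_eqVlt => /predU1P[->|/IHk].
  exact: sin_theta_exp2_half.
apply: le_trans; rewrite ler_pM2l; last lra.
by have := sin_theta_exp2_half R k; have := sin_theta_exp2_gt0 R k.+1; lra.
Qed.

(** For j < k, [y] would be at least 7/8 of the larger sine, hence at least 49/40 of the smaller
    one, yet at most 9/8 = 45/40 of the smaller one. *)
Lemma approximations_disjoint (R : realType) (e y : R) (j k : nat) :
  0 < e <= 4^-1 ->
  `|sin (theta R (2 ^ j)) - y| <= e / (2 * (2 ^ j)%:R) ->
  `|sin (theta R (2 ^ k)) - y| <= e / (2 * (2 ^ k)%:R) ->
  j = k.
Proof.
wlog jk : j k / (j < k)%N => [wlog_lt e14 hj hk|/andP[e0 e4]].
  by case: (ltngtP j k) => // [jk|kj]; [|apply/esym]; apply: wlog_lt.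
have radius i : e / (2 * (2 ^ i)%:R) <= 8^-1 * sin (theta R (2 ^ i)).
  rewrite natrX invfM mulrA ler_pM ?sin_theta_exp2_ge ?invr_ge0 ?exprn_ge0 //;
    lra.
rewrite !ler_distl => /andP[_ hj] /andP[hk _]; exfalso.
have := sin_theta_exp2_gap R jk; have := sin_theta_exp2_gt0 R k.
have := radius j; have := radius k; lra.
Qed.

(** The extra factor [1] pads shorter products, so exactly [n] factors cover every length up to [n];
    repeated values are kept, which makes the size an exact power. *)
Fixpoint products (A : pzRingType) (gs : seq A) (n : nat) : seq A :=
  if n is n'.+1 then [seq u * v | u <- 1 :: gs, v <- products gs n']
  else [:: 1].

Lemma size_products (A : pzRingType) (gs : seq A) (n : nat) :
  size (products gs n) = ((size gs).+1 ^ n)%N.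
Proof.
by elim: n => // n IHn; rewrite [LHS]size_allpairs IHn expnS.
Qed.

Lemma prod_in_products (A : pzRingType) (gs s : seq A) (n : nat) :
  {subset s <= gs} -> (size s <= n)%N -> \prod_(u <- s) u \in products gs n.
Proof.
elim: n s => [|n IHn] [|u s] //= sub le_s; rewrite ?big_nil ?inE //.
  have := allpairs_f (@GRing.mul A) (mem_head 1 gs) (IHn [::] _ _).
  by rewrite big_nil mulr1; apply.
rewrite big_cons; apply: (allpairs_f (@GRing.mul A) (s := 1 :: gs)).
  by rewrite inE sub ?orbT ?mem_head.
by apply: IHn => // v vs; rewrite sub // inE vs orbT.
Qed.

Lemma leq_card_products (A : pzRingType) (gs : seq A) (n N : nat)
  (f : 'I_N -> A) :
  injective f -> (forall i, f i \in products gs n) ->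
  (N <= (size gs).+1 ^ n)%N.
Proof.
move=> f_inj f_in; rewrite -size_products.
rewrite -[N in (N <= _)%N]size_enum_ord -(size_map f).
apply: uniq_leq_size; first by rewrite map_inj_uniq ?enum_uniq.
by move=> _ /mapP[i _ ->].
Qed.

Lemma ln2_le1 (R : realType) : ln 2 <= 1 :> R.
Proof. by have := @le_ln1Dx R 1; apply; lra. Qed.

Theorem theorem3 (R : realType) (G : set 'M[R[i]]_2)
  (finG : finite_set G)
  (unitaryG : forall U : 'M[R[i]]_2, G U -> U \is unitarymx)
  (universalG : universal G) :
  ~ exists l : nat -> R -> R,
      littleo_infty_0 l (fun p0 e => ln (e^-1 * ln p0%:R)) /\
      exists (P0 : nat) (e0 : R), 0 < e0 /\
        forall (p0 : nat) (e : R), (P0 <= p0)%N -> 0 < e <= e0 ->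
        forall p : nat, (1 <= p <= p0)%N ->
        exists s : seq 'M[R[i]]_2,
          [/\ gate_array G s, (size s)%:R <= l p0 e
            & approximates s (rotation (theta R p)) (e / (2 * p%:R))].
Proof.
move=> [l [l_small [P0 [e0 [e0_gt0 approx]]]]].
have /finite_seqP[gs defG] := finG.
(* [.+2] instead of [.+1] gives a positive logarithm even if [gs] is empty. *)
set lnb : R := ln (size gs).+2%:R.
have lnb_gt0 : 0 < lnb by rewrite ln_gt0 // ltr1n.
(* With this constant, ln (n + 1) <= l * [lnb] becomes (n + 1)^2 <= e^-1 * ln (2^n), a quadratic
   against a linear function of n. *)
have /l_small[P [e1 [e1_gt0 l_le]]] : 0 < (2 * lnb)^-1.
  by rewrite invr_gt0 mulr_gt0.
pose e : R := Num.min (Num.min e0 e1) 4^-1.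
have e_gt0 : 0 < e by rewrite !lt_min e0_gt0 e1_gt0 invr_gt0 ltr0n.
have e_le4 : e <= 4^-1 by rewrite ge_min lexx orbT.
have e_le0 : e <= e0 by rewrite !ge_min lexx.
have e_le1 : e <= e1 by rewrite !ge_min lexx orbT.
(* Large enough that 2^n passes both thresholds and that e^-1 <= n. *)
pose n := (maxn P P0 + (Num.truncn e^-1).+1)%N.
have n_lt2n : (n < 2 ^ n)%N by rewrite ltn_expl.
have [PP PP0] : (P <= 2 ^ n)%N /\ (P0 <= 2 ^ n)%N.
  by split; apply: leq_trans (ltnW n_lt2n); apply: leq_trans (leq_addr _ _);
    rewrite ?leq_maxl ?leq_maxr.
have /choice[s s_spec] (j : 'I_n.+1) : exists s : seq 'M[R[i]]_2,
    [/\ gate_array G s, (size s)%:R <= l (2 ^ n)%N e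
      & approximates s (rotation (theta R (2 ^ j))) (e / (2 * (2 ^ j)%:R))].
  apply: approx; rewrite ?e_gt0 //.
  by rewrite expn_gt0 leq_exp2l ?leq_ord.
(* [l] may take negative values in general; here it bounds the length of an actual array, so
   truncating it is safe. *)
have l_ge0 : 0 <= l (2 ^ n)%N e.
  by have [_ + _] := s_spec ord0; apply: le_trans.
have card : (n.+1 <= (size gs).+1 ^ Num.truncn (l (2 ^ n)%N e))%N.
  apply: (@leq_card_products _ gs _ _ (fun j => array_product (s j))).
    move=> j k eq_jk; apply: val_inj.
    have [_ _ /approximates_rotation_entry hj] := s_spec j.
    have [_ _ /approximates_rotation_entry hk] := s_spec k.
    move: hj; rewrite eq_jk => hj.
    by apply: approximations_disjoint hj hk; rewrite e_gt0.
  move=> j; have [Gs size_s _] := s_spec j.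
  apply: prod_in_products; last by rewrite truncn_ge_nat.
  by move=> U /Gs; rewrite defG.
have ln_card : ln n.+1%:R <= l (2 ^ n)%N e * lnb.
  have -> : l (2 ^ n)%N e * lnb = ln ((size gs).+2%:R `^ l (2 ^ n)%N e).
    by rewrite ln_powR.
  rewrite ler_ln ?posrE ?powR_gt0 ?ltr0n //.
  apply: (@le_trans _ _ ((size gs).+2%:R `^ (Num.truncn (l (2 ^ n)%N e))%:R)).
    rewrite powR_mulrn //.
    set L := Num.truncn _ in card *.
    have /le_trans : n.+1%:R <= (size gs).+1%:R ^+ L :> R.
      by rewrite -natrX ler_nat.
    by apply; rewrite lerXn2r ?nnegrE ?ler_nat.
  by rewrite ler_powR ?truncn_le // ler1n.
have /(l_le _ _ PP) : 0 < e <= e1 by rewrite e_gt0.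
rewrite -(ler_pM2r lnb_gt0) => /(le_trans ln_card).
have -> (x : R) : (2 * lnb)^-1 * x * lnb = 2^-1 * x.
  by field; rewrite gt_eqF.
rewrite ler_pdivlMl // mulr_natl -lnXn // natrX [ln (2 ^+ n)]lnXn //.
have ln2_gt0 : 0 < ln 2 :> R by rewrite ln_gt0 // ltr1n.
have n_gt0 : (0 < n)%N by rewrite /n addnS.
rewrite ler_ln ?posrE ?exprn_gt0 ?mulr_gt0 ?invr_gt0 ?mulrn_wgt0 //.
have e_lt_n : e^-1 <= n%:R.
  apply: ltW; apply: lt_le_trans (truncnS_gt _) _.
  by rewrite ler_nat leq_addl.
have n_ge0 : 0 <= n%:R :> R by [].
have := ln2_le1 R.
have : 0 < e^-1 by rewrite invr_gt0.
rewrite -[ln 2 *+ n]mulr_natl -[n.+1%:R]natr1.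
move: (e^-1) (n%:R) (ln 2) e_lt_n n_ge0 ln2_gt0 => x y z xy y0 z0 x0 z1.
apply/negP; rewrite -ltNge.
(* Here x = e^-1 <= y = n and z = ln 2 <= 1, so the right side stays below (n + 1)^2. *)
have : x * (y * z) <= y * y by apply: ler_pM; nra.
nra.
Qed.
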